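(* Let $n,k,\ell$ be positive integers, let $p$ be a prime divisor of $n$, let $\Gamma=\mathrm{Cay}(\mathbb{Z}_n,\{x^k,x^{-k},x^\ell,x^{-\ell}\})$ be a connected circulant quartic graph, and let $C$ be an $(a,b)$-regular set in $\Gamma$. Suppose that $p\nmid k$ and $p\nmid\ell$. If one of the following conditions holds: (i) $p=2$ and $b-a\notin\{-4,4\}$; (ii) $p=3$ and $b-a\notin\{-4,2\}$; (iii) $p=5$, $b-a\neq-4$, and $k\equiv\pm r\pmod 5$ and $\ell\equiv\pm r\pmod 5$ for some $r\in\{1,2\}$; (iv) $p=5$, $b-a\notin\{-4,1\}$, and $k\equiv\pm r_1\pmod 5$ and $\ell\equiv\pm r_2\pmod 5$ for some distinct $r_1,r_2\in\{1,2\}$; (v) $p>5$ and $b-a\neq-4$; then $$|x^h\langle x^p\rangle\cap C|=\frac{bn}{p(4+b-a)}$$ for every $0\le h\le p-1$.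
   Context: $\mathbb{Z}_n=\langle x\rangle$ denotes the cyclic group of order $n$, written multiplicatively. For a finite group $G$ with identity $e$ and an inverse-closed subset $S\subseteq G\setminus\{e\}$, the Cayley graph $\mathrm{Cay}(G,S)$ is the simple graph with vertex set $G$ in which $y$ and $z$ are adjacent if and only if $y^{-1}z\in S$. A circulant quartic graph is a graph $\mathrm{Cay}(\mathbb{Z}_n,\{x^k,x^{-k},x^\ell,x^{-\ell}\})$ where $x^k,x^{-k},x^\ell,x^{-\ell}$ are four distinct non-identity elements. For a graph $\Gamma$ and nonnegative integers $a,b$, a nonempty proper subset $C$ of $V(\Gamma)$ is an $(a,b)$-regular set of $\Gamma$ if every vertex in $C$ has exactly $a$ neighbours in $C$ and every vertex in $V(\Gamma)\setminus C$ has exactly $b$ neighbours in $C$. In (iii) and (iv) the signs in the two congruences are independent. *)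

(* Defs.v *)
From mathcomp Require Import all_boot all_order all_algebra all_fingroup.

Set Implicit Arguments.
Unset Strict Implicit.
Unset Printing Implicit Defensive.

Import GroupScope.

Definition cayley (gT : finGroupType) (S : {set gT}) : rel gT :=
  fun y z => y^-1 * z \in S.

Lemma cayley_irreflexive (gT : finGroupType) (S : {set gT}) :
  1 \notin S -> irreflexive (cayley S).
Proof. by move=> S1 y; rewrite /cayley mulVg; apply: negbTE. Qed.

Lemma cayley_symmetric (gT : finGroupType) (S : {set gT}) :
  S^-1 = S -> symmetric (cayley S).
Proof. by move=> SV y z; rewrite /cayley -{1}SV inE invMg invgK. Qed.

Definition circulant_conn (gT : finGroupType) (x : gT) (k l : nat) : {set gT} :=
  [set x ^+ k; x ^- k; x ^+ l; x ^- l].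

Lemma circulant_conn_inv (gT : finGroupType) (x : gT) (k l : nat) :
  (circulant_conn x k l)^-1 = circulant_conn x k l.
Proof.
apply/setP=> y; rewrite !inE !eqg_invLR !invgK.
by rewrite -!orbA orbCA; do 2!congr orb; rewrite orbC.
Qed.

Definition quartic_exponents (gT : finGroupType) (x : gT) (k l : nat) : bool :=
  uniq [:: 1; x ^+ k; x ^- k; x ^+ l; x ^- l].

Definition graph_connected (T : finType) (e : rel T) : Prop :=
  forall y z : T, connect e y z.

Definition regular_set (T : finType) (e : rel T) (a b : nat) (C : {set T}) : Prop :=
  [/\ C != set0,
      C \proper [set: T],
      forall v, v \in C -> #|[set w in C | e v w]| = a &
      forall v, v \notin C -> #|[set w in C | e v w]| = b].

(* m is congruent to r or to - r modulo d; stated over int because - r is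
   meaningless with the truncated subtraction of nat. *)
Definition eqmod_pm (d m r : nat) : Prop :=
  (m%:Z = r%:Z %[mod d%:Z])%Z \/ (m%:Z = - r%:Z %[mod d%:Z])%Z.

(* Main.v *)
Require Import Defs.
From mathcomp Require Import all_boot all_order all_algebra all_fingroup all_field cyclic zify ring.
Import GRing.Theory Num.Theory.
Local Open Scope ring_scope.

(** Let z be a primitive p-th root of unity in algC and chi the character
    x ^+ i |-> z ^+ i of the cyclic group G = <[x]>, of order divisible by p.
    Writing S for the connection set, regularity of C says that
    #|[set w in C | v^-1 * w \in S]| is a on C and b off C.
    Weighting this by chi v and summing over v gives
      (\sum_(s in S) chi s) * (\sum_(v in C) chi v)
        = b * \sum_v chi v + (a - b) * \sum_(v in C) chi v,
    and \sum_v chi v = 0 because chi is nontrivial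
    (regular_set_character). So one of the two factors
    \sum_(s in S) chi s - (a - b) and \sum_(v in C) chi v vanishes.

    Each factor is a rational combination of 1, z, ..., z ^+ p.-1, whose
    coefficients count elements of S or C by the residue mod p of their
    exponent. As 1 + 'X + ... + 'X^(p-1) is irreducible over the rationals,
    such a combination vanishes only if all its coefficients are equal
    (prime_root_relation_const).

    If the sum over C vanishes, then C meets all cosets of <[x ^+ p]> in the
    same number c of elements, so #|C| = p * c; the displayed identity for the
    trivial character, 4 * #|C| = b * n + (a - b) * #|C|, then gives c.

    If the other factor vanishes, every nonzero residue class mod p contains
    exactly b - a elements of S (the class 0 contains none, since p divides
    neither k nor l). Hence (p - 1) * (b - a) = 4, which leaves the pairs
    (2, 4), (3, 2), (5, 1) for (p, b - a). They are excluded by hypothesis,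
    except (5, 1) when k and l agree up to sign mod 5; but then the elements of
    S occupy only two of the four nonzero classes. *)

(** The combination obtained by subtracting q p.-1 times
    1 + z + ... + z ^+ p.-1 = 0 has degree less than p.-1, the degree of the
    minimal polynomial of z over the rationals, so it is the zero polynomial. *)
Lemma prime_root_relation_const {p : nat} {z : algC} {q : nat -> rat} :
  prime p -> p.-primitive_root z ->
  \sum_(h < p) ratr (q h) * z ^+ h = 0 ->
  forall i, (i < p)%N -> q i = q p.-1.
Proof.
move=> p_pr z_prim rel i lt_ip; have p_gt1 := prime_gt1 p_pr.
have p_gt0 := prime_gt0 p_pr.
have geom0 : \sum_(h < p) z ^+ h = 0.
  have /eqP := subrX1 z p; rewrite (prim_expr_order z_prim) subrr eq_sym mulf_eq0.
  case/orP=> /eqP // /eqP; rewrite subr_eq0 -[z]expr1 -(prim_order_dvd z_prim).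
  by rewrite dvdn1 => /eqP p1; rewrite p1 in p_gt1.
pose P := \poly_(h < p.-1) (q h - q p.-1).
have rootP : root (map_poly ratr P) z.
  have -> : map_poly ratr P = \poly_(h < p.-1) ratr (q h - q p.-1) :> {poly algC}.
    apply/polyP=> h; rewrite coef_map !coef_poly /=.
    by case: ifP => // _; rewrite rmorph0.
  rewrite rootE horner_poly.
  apply/eqP; transitivity (\sum_(h < p) ratr (q h - q p.-1) * z ^+ h).
    by rewrite -[in RHS](prednK p_gt0) big_ord_recr /= subrr rmorph0 mul0r addr0.
  under eq_bigr do rewrite rmorphB mulrBl.
  by rewrite sumrB rel -mulr_sumr geom0 mulr0 subrr.
have [m [m_def _ root_dvd]] := minCpolyP z.
have size_m : size m = p.
  have := size_map_poly (ratr : {rmorphism rat -> algC}) m.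
  rewrite -m_def (minCpoly_cyclotomic z_prim) size_cyclotomic totient_prime //.
  by rewrite prednK.
have P0 : P = 0.
  apply/eqP; apply: contraTT rootP => nzP; rewrite root_dvd.
  apply/negP=> /(dvdp_leq nzP); rewrite size_m leqNgt => /negP[].
  by rewrite -[ltnRHS](prednK p_gt0) ltnS size_poly.
have [ltip | ] := ltnP i p.-1.
  apply/eqP; rewrite -subr_eq0; apply/eqP.
  by have := congr1 (fun Q : {poly rat} => Q`_i) P0; rewrite coef_poly ltip coef0.
move=> le_pi; congr q; apply/eqP; rewrite eqn_leq le_pi andbT.
by rewrite -ltnS prednK.
Qed.

Lemma sum_fibers {T : finType} {R : nzRingType} (A : {set T}) {r : T -> nat}
    {p : nat} (F : nat -> R) :
  (forall v, r v < p)%N ->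
  \sum_(v in A) F (r v) = \sum_(h < p) #|[set v in A | r v == h]|%:R * F h.
Proof.
move=> r_lt; rewrite (partition_big (fun v => Ordinal (r_lt v)) predT) //=.
apply: eq_bigr => h _; rewrite -sum1_card natr_sum mulr_suml.
apply: eq_big => [v | v /andP[_ /eqP <-]]; last by rewrite mul1r.
by rewrite inE -val_eqE.
Qed.

(** Both sides equal the chi-weighted sum over all vertices v of the number of
    neighbours of v in C: the left one by summing over the neighbours w in C
    first and substituting v = w * s, the right one by regularity, separating
    C from its complement. *)
Lemma regular_set_character {gT : finGroupType} {R : comNzRingType}
    {chi : gT -> R} {S C : {set gT}} {a b : nat} :
  {morph chi : v w / (v * w)%g >-> v * w} -> (S^-1 = S)%g ->
  regular_set (cayley S) a b C ->
  (\sum_(s in S) chi s) * (\sum_(v in C) chi v)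
    = b%:R * (\sum_v chi v) + (a%:R - b%:R) * (\sum_(v in C) chi v).
Proof.
move=> chiM SV [_ _ regC regNC].
transitivity (\sum_v chi v * #|[set w in C | cayley S v w]|%:R).
  rewrite mulrC big_distrl /=.
  under [RHS]eq_bigr => v _.
    rewrite -sum1_card natr_sum big_distrr /=.
    under eq_bigl do rewrite inE; over.
  rewrite (exchange_big_dep (mem C)) /=; last by move=> v w _ /andP[].
  apply: eq_bigr => w wC; rewrite big_distrr /=.
  rewrite (reindex_inj (mulgI w^-1)%g) /=.
  apply: eq_big => [v | v _]; last by rewrite -chiM mulKVg mulr1.
  by rewrite wC /cayley -{1}SV inE invMg invgK.
rewrite !mulr_sumr (bigID (mem C)) [X in _ = X + _](bigID (mem C)) /=.
rewrite addrAC -big_split /=; congr (_ + _); apply: eq_bigr => v vC.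
  by rewrite regC // -mulrDl [LHS]mulrC addrC subrK.
by rewrite regNC // mulrC.
Qed.

(** The discrete logarithm to the base x, reduced mod p; for p dividing #[x] it
    is the quotient map of <[x]> onto the integers mod p, whose fibres are the
    cosets of <[x ^+ p]>. The values are plain naturals so that they can serve
    as exponents. *)
Definition cyclic_residue {gT : finGroupType} (x : gT) (p : nat) (v : gT) : nat :=
  (index v [seq (x ^+ i)%g | i <- iota 0 #[x]%g] %% p)%N.

Lemma cyclic_residueX {gT : finGroupType} (x : gT) (p i : nat) :
  (p %| #[x]%g)%N -> cyclic_residue x p (x ^+ i)%g = (i %% p)%N.
Proof.
move=> p_dvd; rewrite /cyclic_residue; set s := map _ _.
have xi_s : (x ^+ i)%g \in s.
  rewrite -expg_mod_order; apply: map_f.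
  by rewrite mem_iota add0n ltn_mod order_gt0.
have := nth_index 1%g xi_s; move: xi_s; rewrite -index_mem size_map size_iota.
move=> lt_in; rewrite (nth_map 0%N) ?size_iota // nth_iota // add0n => /eqP.
by rewrite eq_expg_mod_order => /eqP eq_i; rewrite -(modn_dvdm _ p_dvd) eq_i modn_dvdm.
Qed.

Lemma cyclic_residueM {gT : finGroupType} (x : gT) (p : nat) (v w : gT) :
  [set: gT] = <[x]>%g -> (p %| #[x]%g)%N ->
  cyclic_residue x p (v * w)%g
    = ((cyclic_residue x p v + cyclic_residue x p w) %% p)%N.
Proof.
move=> x_gen p_dvd.
have /cycleP[i ->] : v \in <[x]>%g by rewrite -x_gen inE.
have /cycleP[j ->] : w \in <[x]>%g by rewrite -x_gen inE.
by rewrite -expgD !cyclic_residueX // modnDm.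
Qed.

(** The two alternatives correspond to the two factors of
    (\sum_(s in S) chi s - (a - b)) * \sum_(v in C) chi v = 0 for a character
    chi of order p. The hypothesis that S avoids the residue class 0 identifies
    the common coefficient of the first factor: its constant coefficient is
    0 - (a - b). *)
Lemma regular_set_residue_dichotomy {gT : finGroupType} (x : gT) (p a b : nat)
    (S C : {set gT}) :
  [set: gT] = <[x]>%g -> prime p -> (p %| #[x]%g)%N -> (S^-1 = S)%g ->
  (forall s, s \in S -> cyclic_residue x p s != 0%N) ->
  regular_set (cayley S) a b C ->
  (forall h, (0 < h < p)%N ->
     #|[set s in S | cyclic_residue x p s == h]|%:R = b%:R - a%:R :> rat) \/
  (forall h, (h < p)%N ->
     (p * #|[set v in C | cyclic_residue x p v == h]|)%N = #|C|).
Proof.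
move=> x_gen p_pr p_dvd SV S_nz C_reg.
have p_gt0 := prime_gt0 p_pr; have p_gt1 := prime_gt1 p_pr.
have [z z_prim] := C_prim_root_exists p_gt0.
set r := cyclic_residue x p in S_nz *; pose chi v := z ^+ r v.
have r_lt v : (r v < p)%N by rewrite ltn_mod.
have chiM : {morph chi : v w / (v * w)%g >-> v * w}.
  by move=> v w; rewrite /chi /r cyclic_residueM // prim_expr_mod // exprD.
have chi_sum0 : \sum_v chi v = 0.
  (* Translation by x multiplies the sum by chi x = z, which is not 1. *)
  have : (chi x - 1) * (\sum_v chi v) = 0.
    rewrite mulrBl mul1r mulr_sumr [X in _ - X](reindex_inj (mulgI x)).
    by rewrite -sumrB big1 // => v _; rewrite chiM subrr.
  move/eqP; rewrite mulf_eq0 subr_eq0 => /orP[|/eqP //].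
  rewrite /chi -(prim_order_dvd z_prim) /r -[x in cyclic_residue _ _ x]expg1.
  by rewrite cyclic_residueX // modn_small // dvdn1 => /eqP p1; rewrite p1 in p_gt1.
have := regular_set_character chiM SV C_reg.
rewrite chi_sum0 mulr0 add0r => /eqP; rewrite -subr_eq0 -mulrBl mulf_eq0.
case/orP=> /eqP; rewrite /chi (sum_fibers _ (fun h => z ^+ h) r_lt).
- set m := fun h => _ => rel; left.
  (* The coefficients of the first factor; the scalar a - b sits in degree 0. *)
  pose q h : rat := #|[set s in S | r s == h]|%:R - (a%:R - b%:R) *+ (h == 0%N).
  have q_const : forall h, (h < p)%N -> q h = q p.-1.
    apply: (prime_root_relation_const p_pr z_prim); rewrite -[RHS]rel.
    under eq_bigr do rewrite rmorphB rmorph_nat mulrBl.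
    rewrite sumrB; congr (_ - _).
    rewrite -[in LHS](prednK p_gt0) big_ord_recl /= big1 ?addr0 => [|i _].
      by rewrite mulr1 rmorphB !rmorph_nat.
    by rewrite rmorph0 mul0r.
  move=> h /andP[h_gt0 lt_hp].
  have := q_const h lt_hp; rewrite -(q_const 0%N p_gt0) /q.
  rewrite eqn0Ngt h_gt0 subr0 => ->.
  suff -> : [set s in S | r s == 0%N] = set0 by rewrite cards0 sub0r opprB.
  apply/setP=> s; rewrite !inE; apply/negP=> /andP[/S_nz].
  by move/negP.
- move=> rel; right.
  pose q h : rat := #|[set s in C | r s == h]|%:R.
  have q_const : forall h, (h < p)%N -> q h = q p.-1.
    apply: (prime_root_relation_const p_pr z_prim); rewrite -[RHS]rel.
    by under eq_bigr do rewrite rmorph_nat.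
  move=> h lt_hp; apply/eqP; rewrite -(eqr_nat rat); apply/eqP.
  rewrite natrM -[#|C|]sum1_card natr_sum (sum_fibers _ (fun=> 1) r_lt).
  under eq_bigr => i _ do rewrite mulr1 -/(q i) q_const //.
  by rewrite sumr_const card_ord -/(q h) q_const // mulr_natl.
Qed.

(** The case of the trivial character: it counts the pairs (v, w) of adjacent
    vertices with w in C in two ways. *)
Lemma regular_set_double_count {gT : finGroupType} (S C : {set gT}) (a b : nat) :
  (S^-1 = S)%g -> regular_set (cayley S) a b C ->
  (#|S| * #|C|)%:R = b%:R * #|gT|%:R + (a%:R - b%:R) * #|C|%:R :> rat.
Proof.
move=> SV C_reg.
have chiM : {morph (fun _ : gT => 1 : rat) : v w / (v * w)%g >-> v * w}.
  by move=> v w; rewrite mulr1.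
have := regular_set_character chiM SV C_reg.
by rewrite !sumr_const natrM.
Qed.

(** The residue of x ^- m is the opposite of m mod p, written as a divisibility
    because of truncated subtraction. *)
Lemma mem_circulant_residue {gT : finGroupType} (x s : gT) (p k l : nat) :
  [set: gT] = <[x]>%g -> (0 < p)%N -> (p %| #[x]%g)%N ->
  s \in circulant_conn x k l ->
  exists2 m, m \in [:: k; l] &
    cyclic_residue x p s = (m %% p)%N \/ (p %| cyclic_residue x p s + m)%N.
Proof.
move=> x_gen p_gt0 p_dvd.
have resV m : (p %| cyclic_residue x p (x ^- m)%g + m)%N.
  have := cyclic_residueM x p (x ^- m)%g (x ^+ m)%g x_gen p_dvd.
  rewrite mulVg -{1}(expg0 x) !cyclic_residueX // mod0n modnDmr => /esym/eqP.
  by [].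
rewrite !inE -!orbA => /or4P[] /eqP->;
  [exists k | exists k | exists l | exists l]; rewrite ?inE ?eqxx ?orbT //;
  by [left; rewrite cyclic_residueX | right].
Qed.

Theorem corollary2p11 (gT : finGroupType) (x : gT) (n k l p a b : nat)
    (C : {set gT})
    (x_gen : [set: gT] = <[x]>%g) (x_order : #[x]%g = n)
    (n_gt0 : (0 < n)%N) (k_gt0 : (0 < k)%N) (l_gt0 : (0 < l)%N)
    (p_prime : prime p) (p_dvd_n : (p %| n)%N)
    (quartic : quartic_exponents x k l)
    (connected : graph_connected (cayley (circulant_conn x k l)))
    (C_regular : regular_set (cayley (circulant_conn x k l)) a b C)
    (p_ndvd_k : ~~ (p %| k)%N) (p_ndvd_l : ~~ (p %| l)%N)
    (cases :
      [\/ p = 2%N /\ b%:Z - a%:Z \notin [:: -4; 4],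
          p = 3%N /\ b%:Z - a%:Z \notin [:: -4; 2],
          [/\ p = 5%N, b%:Z - a%:Z != -4 &
              exists r : nat,
                [/\ r \in [:: 1%N; 2%N], eqmod_pm 5 k r & eqmod_pm 5 l r]] |
          [/\ p = 5%N, b%:Z - a%:Z \notin [:: -4; 1] &
              exists r1 r2 : nat,
                [/\ r1 \in [:: 1%N; 2%N] /\ r2 \in [:: 1%N; 2%N], r1 != r2,
                    eqmod_pm 5 k r1 & eqmod_pm 5 l r2]] ]
      \/ ((5 < p)%N /\ b%:Z - a%:Z != -4)) :
  forall h : nat, (h <= p.-1)%N ->
    (#|((x ^+ h)%g *: <[x ^+ p]>)%g :&: C|)%:R
      = (b * n)%:R / (p%:R * (4 + b%:R - a%:R)) :> rat.
Proof.
subst n; move=> h le_hp.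
have p_gt0 := prime_gt0 p_prime; have p_gt1 := prime_gt1 p_prime.
have lt_hp : (h < p)%N by rewrite -(prednK p_gt0) ltnS.
have SV : ((circulant_conn x k l)^-1 = circulant_conn x k l)%g.
  exact: circulant_conn_inv.
set S := circulant_conn x k l in C_regular SV connected *.
pose r := cyclic_residue x p.
have r_lt v : (r v < p)%N by rewrite ltn_mod.
have card_S : #|S| = 4%N.
  have := quartic; rewrite /quartic_exponents cons_uniq => /andP[_].
  move/card_uniqP=> /= <-; apply: eq_card => s.
  by rewrite /S /circulant_conn !inE -!orbA.
have S_nz s : s \in S -> r s != 0%N.
  case/(mem_circulant_residue _ _ p _ _ x_gen p_gt0 p_dvd_n) => m m_kl.
  have m_nd : ~~ (p %| m)%N by move: m_kl; rewrite !inE => /orP[] /eqP->.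
  rewrite -/(r s) => -[-> // | ].
  by apply: contraTneq => ->; rewrite add0n.
have coset_eq : ((x ^+ h)%g *: <[x ^+ p]>)%g :&: C = [set v in C | r v == h].
  apply/setP=> v; rewrite !inE andbC; congr (_ && _).
  apply/lcosetP/eqP => [[_ /cycleP[i ->] ->] | rv].
    by rewrite -expgM -expgD /r cyclic_residueX // addnC mulnC modnMDl modn_small.
  have /cycleP[i v_def] : v \in <[x]>%g by rewrite -x_gen inE.
  exists (x ^+ p ^+ (i %/ p))%g; first exact: mem_cycle.
  rewrite -rv v_def /r cyclic_residueX // -expgM -expgD.
  by rewrite addnC mulnC -divn_eq.
have [S_flat | C_flat] := regular_set_residue_dichotomy x p a b S C
  x_gen p_prime p_dvd_n SV S_nz C_regular.
- exfalso.
  (* Adding up the p.-1 nonzero residue classes of S. *)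
  have card4 : p.-1%:Z * (b%:Z - a%:Z) = 4.
    apply: (@intr_inj rat); rewrite rmorphM rmorphB /= -!pmulrn.
    have := sum_fibers S (fun=> 1 : rat) r_lt.
    rewrite sumr_const card_S -[in RHS](prednK p_gt0) big_ord_recl /=.
    under eq_bigr => i _.
      rewrite mulr1 S_flat; last by rewrite /= -ltn_predRL ltn_ord.
      over.
    rewrite sumr_const card_ord mulr1.
    suff -> : [set s in S | r s == 0%N] = set0.
      by rewrite cards0 add0r mulr_natl => <-.
    by apply/setP=> s; rewrite in_set in_set0; apply/andP=> -[/S_nz/negP].
  case: cases => [[[p2]|[p3]|[p5 _ [r0 [r0_12 k_r0 l_r0]]]|[p5 + _]]|[p_gt5 _]].
  + by rewrite p2 /= in card4; rewrite !inE; lia.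
  + by rewrite p3 /= in card4; rewrite !inE; lia.
  (* Here k and l are r0 or - r0 mod 5, so no element of S lies in the class of
     3 - r0, the other element of {1, 2}; yet that class should contain
     b - a = 1 element. *)
  + have /S_flat : (0 < 3 - r0 < p)%N by move: r0_12; rewrite p5 !inE; lia.
    have -> : b%:R - a%:R = 1 :> rat.
      have ba1 : b%:Z - a%:Z = 1 by rewrite p5 /= in card4; lia.
      by rewrite !pmulrn -rmorphB /= ba1.
    move/eqP; rewrite pnatr_eq1 => /eqP cS.
    have /card_gt0P[s] : (0 < #|[set s in S | r s == 3 - r0]|)%N by rewrite cS.
    rewrite inE => /andP[/(mem_circulant_residue _ _ p _ _ x_gen p_gt0 p_dvd_n)].
    case=> m m_kl res_s /eqP rs.
    have: eqmod_pm 5 m r0 by move: m_kl; rewrite !inE => /orP[] /eqP->.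
    move: res_s r0_12; rewrite -/(r s) rs p5 !inE.
    by rewrite /eqmod_pm; lia.
  + by rewrite p5 /= in card4; rewrite !inE; lia.
  + have p1_ge5 : 5 <= p.-1%:Z by lia.
    by have [d_le0 | d_gt0] := lerP (b%:Z - a%:Z) 0; nia.
- have theta_nz : 4 + b%:R - a%:R != 0 :> rat.
    have: 4 + b%:Z - a%:Z != 0.
      case: cases => [[[_ +]|[_ +]|[_ + _]|[_ + _]]|[_ +]];
        by rewrite ?inE; lia.
    by rewrite -(intr_eq0 rat) rmorphB rmorphD.
  have := regular_set_double_count S C a b SV C_regular.
  rewrite -(C_flat h lt_hp) -coset_eq card_S -cardsT x_gen -/(#[x]%g).
  set c := #|_|; rewrite !natrM => count.
  have p_nz : p%:R != 0 :> rat by rewrite pnatr_eq0 -lt0n.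
  apply: (canRL (mulfK _)); first by rewrite mulf_neq0.
  apply/eqP; rewrite -subr_eq0; apply/eqP; ring: count.
Qed.
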